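(* Every poset space has the strong Choquet property: for every poset $P$, both $\mathrm{MF}(P)$ and $\mathrm{UF}(P)$ have the strong Choquet property.
   Context: A poset is a set $P$ with a reflexive, antisymmetric, transitive relation $\preceq$; $p\prec q$ means $p\preceq q$ and $p\neq q$. A filter on $P$ is a nonempty subset $F\subseteq P$ such that (1) for all $p,q\in F$ there is $r\in F$ with $r\preceq p$ and $r\preceq q$, and (2) if $p\in F$, $q\in P$ and $p\preceq q$ then $q\in F$. A filter $F$ is unbounded if there is no $r\in P$ with $r\prec q$ for every $q\in F$; it is maximal if no strictly larger filter contains it (every maximal filter is unbounded). $\mathrm{UF}(P)$ is the set of unbounded filters on $P$, with the topology having basis $\{N_p : p\in P\}$, where $N_p=\{F\in \mathrm{UF}(P) : p\in F\}$; $\mathrm{MF}(P)\subseteq \mathrm{UF}(P)$ is the set of maximal filters, with the subspace topology. A poset space is a space of the form $\mathrm{MF}(P)$ or $\mathrm{UF}(P)$. The strong Choquet game on a topological space $X$ is played by players I and II in stages $i=0,1,2,\ldots$. At stage $i$, player I plays an open set $U_i$ and a point $x_i\in U_i$, with $U_i\subseteq V_{i-1}$ if $i>0$; then player II plays an open set $V_i$ with $x_i\in V_i\subseteq U_i$. Player II wins if $\bigcap_i U_i\neq\varnothing$ (equivalently $\bigcap_i V_i\ne\varnothing$); otherwise player I wins. $X$ has the strong Choquet property if player II has a winning strategy, i.e. a function assigning to each finite position in which player II is to move a legal move of player II, such that player II wins every infinite play in which player II's moves are given by this function. *)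

(* Defs.v *)
From HB Require Import structures.
From mathcomp Require Import all_boot all_order.
From mathcomp Require Import boolp classical_sets topology.

Set Implicit Arguments.
Unset Strict Implicit.
Unset Printing Implicit Defensive.

Import Order.TTheory.

Local Open Scope classical_set_scope.
Local Open Scope order_scope.

Section PosetFilter.
Context {d : Order.disp_t} {P : porderType d}.
Implicit Types F G : set P.

(* Filters in the sense of order theory; not the library's [Filter], which is
   about sets of sets. *)
Definition poset_filter F : Prop :=
  [/\ F !=set0,
      forall p q, F p -> F q -> exists r, [/\ F r, r <= p & r <= q] &
      forall p q, F p -> p <= q -> F q].

Definition unbounded_filter F : Prop :=
  poset_filter F /\ ~ exists r : P, forall q, F q -> r < q.

Definition maximal_filter F : Prop :=
  poset_filter F /\ forall G, poset_filter G -> F `<=` G -> G = F.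

(* Hence carving the maximal filters out of the unbounded ones, as [MF] does
   below, omits none of them. *)
Lemma maximal_filter_unbounded F : maximal_filter F -> unbounded_filter F.
Proof.
move=> [Ff Fmax]; split=> // -[r rF].
have Gf : poset_filter [set q | r <= q].
  split=> [|p q rp rq|p q rp pq]; first by exists r => /=.
  - by exists r; split=> //=.
  - exact: le_trans rp pq.
have Fr : F r by rewrite -(Fmax _ Gf) //= => q /rF /ltW.
by have := rF _ Fr; rewrite ltxx.
Qed.

End PosetFilter.

Record UF {d : Order.disp_t} (P : porderType d) := MkUF {
  UF_set : set P;
  UF_unbounded : unbounded_filter UF_set
}.

HB.instance Definition _ d (P : porderType d) := gen_eqMixin (UF P).
HB.instance Definition _ d (P : porderType d) := gen_choiceMixin (UF P).

Section UFTopology.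
Context {d : Order.disp_t} {P : porderType d}.

Definition UF_nbhd (p : P) : set (UF P) := [set F : UF P | UF_set F p].

Let UF_cover : \bigcup_(B in range UF_nbhd) B = setT.
Proof.
rewrite -subTset => F _; have [[[p Fp] _ _] _] := UF_unbounded F.
by exists (UF_nbhd p) => //; exists p.
Qed.

Let UF_join (A B : set (UF P)) (F : UF P) :
  range UF_nbhd A -> range UF_nbhd B -> A F -> B F ->
  exists C, [/\ range UF_nbhd C, C F & C `<=` A `&` B].
Proof.
move=> [p _ <-] [q _ <-] Fp Fq.
have [[_ Fdir _] _] := UF_unbounded F.
have [r [Fr rp rq]] := Fdir p q Fp Fq.
exists (UF_nbhd r); split=> // G Gr.
have [[_ _ Gup] _] := UF_unbounded G.
by split; [exact: Gup rp|exact: Gup rq].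
Qed.

(* The base is indexed by its own members because the factory wants a pointed
   index type, and [P] may be empty. *)
HB.instance Definition _ :=
  isBaseTopological.Build (UF P) UF_cover UF_join.

End UFTopology.

(* As a type, [MF P] is [set_type (MF P)], which the library equips with the
   subspace topology inherited from [UF P]. *)
Definition MF {d : Order.disp_t} (P : porderType d) : set (UF P) :=
  [set F | maximal_filter (UF_set F)].
Arguments MF {d} P.

Section StrongChoquet.
Variable X : topologicalType.

(* One completed stage (U_i, x_i, V_i). *)
Record stage := Stage {
  stageU : set X;
  stagex : X;
  stageV : set X
}.

(* [h] lists the completed stages in chronological order; on the empty history
   [last] returns [setT], so that U_0 is unconstrained. *)
Definition legalI (h : seq stage) (U : set X) (x : X) : Prop :=
  [/\ open U, U x & U `<=` last setT (map stageV h)].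

Definition legalII (U : set X) (x : X) (V : set X) : Prop :=
  [/\ open V, V x & V `<=` U].

Inductive legal_history : seq stage -> Prop :=
| legal_history_nil : legal_history [::]
| legal_history_rcons h U x V :
    legal_history h -> legalI h U x -> legalII U x V ->
    legal_history (rcons h (Stage U x V)).

(* A position in which II is to move is a history together with the pending
   move (U, x) of I. *)
Definition moveII := seq stage -> set X -> X -> set X.

Definition strategyII (sigma : moveII) : Prop :=
  forall h U x, legal_history h -> legalI h U x -> legalII U x (sigma h U x).

Definition legal_play (play : nat -> stage) : Prop :=
  forall i, legalI (mkseq play i) (stageU (play i)) (stagex (play i)) /\
    legalII (stageU (play i)) (stagex (play i)) (stageV (play i)).

Definition follows (sigma : moveII) (play : nat -> stage) : Prop :=
  forall i, stageV (play i) =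
    sigma (mkseq play i) (stageU (play i)) (stagex (play i)).

Definition winsII (play : nat -> stage) : Prop :=
  \bigcap_i stageU (play i) !=set0.

Definition strong_choquet : Prop :=
  exists sigma : moveII, strategyII sigma /\
    forall play, legal_play play -> follows sigma play -> winsII play.

End StrongChoquet.

(* Main.v *)
Require Import Defs.
From mathcomp Require Import all_boot all_order.
From mathcomp Require Import boolp classical_sets functions topology.

(** Player II answers [(U, x)] with a basic set [N_p], where [p] lies in the
    filter [x], [N_p] is contained in [U], and [p] is below the element chosen
    at the previous stage. The elements chosen along a play form a decreasing
    sequence, so their upward closure is a filter; a maximal filter extending it
    lies in every [N_p] played, hence in every open set played by I. *)

Set Implicit Arguments.
Unset Strict Implicit.
Unset Printing Implicit Defensive.

Import Order.TTheory.

Local Open Scope order_scope.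
Local Open Scope classical_set_scope.

Section PosetFilters.
Context {d : Order.disp_t} {P : porderType d}.
Implicit Types (F G : set P) (p q : P).

(** Zorn's lemma applies since any two members of a chain are comparable: the larger one supplies a
    common lower bound. *)
Lemma maximal_filter_extension F :
  poset_filter F -> exists2 G, maximal_filter G & F `<=` G.
Proof.
move=> Ff.
(* The filters extending [F] are encoded as the sets [F `|` A], so that the
   empty chain is bounded by [F]. *)
have [C CQ Ctot|A [FAf Amax]] :=
    @Zorn_bigcup P [set A | poset_filter (F `|` A)].
  rewrite /=; have [[p0 Fp0] Fdir Fup] := Ff; split.
  - by exists p0; left.
  - move=> p q [Fp|[X CX Xp]] [Fq|[Y CY Yq]].
    + by have [r [Fr rp rq]] := Fdir p q Fp Fq; exists r; split=> //; left.
    + have [_ dirY _] := CQ Y CY.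
      have [|r [FYr rp rq]] := dirY p q _ (or_intror Yq); first by left.
      exists r; split=> //; case: FYr => [|Yr]; first by left.
      by right; exists Y.
    + have [_ dirX _] := CQ X CX.
      have [|r [FXr rp rq]] := dirX p q (or_intror Xp); first by left.
      exists r; split=> //; case: FXr => [|Xr]; first by left.
      by right; exists X.
    + have [Z [CZ Zp Zq]] : exists Z, [/\ C Z, Z p & Z q].
        by have [XY|YX] := Ctot X Y CX CY; [exists Y|exists X]; split=> //;
          [exact: XY|exact: YX].
      have [_ dirZ _] := CQ Z CZ.
      have [r [FZr rp rq]] := dirZ p q (or_intror Zp) (or_intror Zq).
      exists r; split=> //; case: FZr => [|Zr]; first by left.
      by right; exists Z.
  - move=> p q [Fp|[X CX Xp]] pq; first by left; exact: Fup pq.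
    have [_ _ upX] := CQ X CX.
    case: (upX p q (or_intror Xp) pq) => [|Xq]; first by left.
    by right; exists X.
exists (F `|` A); last exact: subsetUl.
split=> // G Gf FAG; apply/seteqP; split=> //.
apply: contrapT => GFA.
(* As [G] contains [F], it is its own union with [F], hence a strictly larger competitor of [A]. *)
have FG : F `<=` G by apply: subset_trans FAG; exact: subsetUl.
apply: (Amax G); last by rewrite /= (setUidr FG).
split; first by apply: subset_trans FAG; exact: subsetUr.
by move=> GA; apply: GFA; apply: subset_trans GA _; exact: subsetUr.
Qed.

Lemma decreasing_sequence_filter (p : nat -> P) :
  (forall i, p i.+1 <= p i) -> poset_filter [set q | exists i, p i <= q].
Proof.
move=> p_dec.
have p_anti i j : (i <= j)%N -> p j <= p i.
  elim: j => [|j IHj]; first by rewrite leqn0 => /eqP ->.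
  rewrite leq_eqVlt => /orP[/eqP -> //|]; rewrite ltnS => /IHj.
  exact: le_trans (p_dec j).
split=> [|q r [i iq] [j jr]|q r [i iq] qr]; first by exists (p 0), 0.
- exists (p (maxn i j)); split; first by exists (maxn i j).
  + by apply: le_trans iq; apply: p_anti; exact: leq_maxl.
  + by apply: le_trans jr; apply: p_anti; exact: leq_maxr.
- by exists i; exact: le_trans qr.
Qed.

Lemma open_UF_nbhd p : open (UF_nbhd p).
Proof.
exists [set UF_nbhd p]; last by rewrite bigcup_set1.
by move=> _ ->; exists p.
Qed.

Lemma UF_nbhd_base (O : set (UF P)) (x : UF P) :
  open O -> O x -> exists2 p, UF_nbhd p x & UF_nbhd p `<=` O.
Proof.
move=> [D DP <-] [B DB Bx]; have [p _ pB] := DP _ DB; exists p.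
  by rewrite pB.
by rewrite pB => y By; exists B.
Qed.

(** Treats both spaces at once: [f] is the inclusion of [MF P] or the identity of [UF P]. The last
    hypothesis turns the maximal filter built from a play into a point of [X]. *)
Lemma strong_choquet_initial (X : topologicalType) (f : X -> UF P) :
  continuous f ->
  (forall U : set X, open U -> exists2 O, open O & U = f @^-1` O) ->
  (forall F, maximal_filter F -> exists x, UF_set (f x) = F) ->
  strong_choquet X.
Proof.
move=> /continuousP f_cts f_base f_max.
pose N p : set X := f @^-1` UF_nbhd p.
have N_open p : open (N p) by apply: f_cts; exact: open_UF_nbhd.
have N_le p q : p <= q -> N p `<=` N q.
  by move=> pq x; have [[_ _ up] _] := UF_unbounded (f x); move/up; exact.
have N_base U x : open U -> U x -> exists2 p, N p x & N p `<=` U.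
  move=> /f_base[O oO ->] Ox; have [p px pO] := UF_nbhd_base oO Ox.
  by exists p => // y /pO.
(* For a history in which II has not followed the strategy, the previous
   choice [q] need not belong to [x]; then no descent is demanded. *)
have /choice[pick pickP] (t : option P * (set X * X)) : exists p,
    open t.2.1 -> t.2.1 t.2.2 -> [/\ N p t.2.2, N p `<=` t.2.1 &
      forall q, t.1 = Some q -> N q t.2.2 -> p <= q].
  case: t => o [U x] /=.
  have [[oU Ux]|nU] := pselect (open U /\ U x); last first.
    (* Default for an illegal move: any element of the filter. *)
    by have [[[p _] _ _] _] := UF_unbounded (f x); exists p => oU Ux; case: nU.
  have [p px pU] := N_base U x oU Ux.
  case: o => [q|]; last by exists p.
  have [qx|nqx] := pselect (N q x); last by exists p => _ _; split=> // _ [<-].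
  have [[_ dir _] _] := UF_unbounded (f x).
  have [r [rx rp rq]] := dir p q px qx.
  exists r => _ _; split=> // [|_ [<-] //].
  exact: subset_trans (N_le _ _ rp) pU.
(* A history records open sets, not elements of [P]; folding [step] over it recomputes the last
   choice from the moves of I, with [None] at the start. *)
pose step o (s : stage X) := Some (pick (o, (stageU s, stagex s))).
pose sigma h U x := N (pick (foldl step None h, (U, x))).
exists sigma; split=> [h U x _ [oU Ux _]|play legal fol].
  have [Nx NU _] := pickP (foldl step None h, (U, x)) oU Ux.
  by split; first exact: N_open.
pose p i := pick (foldl step None (mkseq play i),
                  (stageU (play i), stagex (play i))).
have VN i : stageV (play i) = N (p i) by exact: fol.
have p_dec i : p i.+1 <= p i.
  have [[oU Ux UV] _] := legal i.+1.
  have [_ _] := pickP (foldl step None (mkseq play i.+1),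
                       (stageU (play i.+1), stagex (play i.+1))) oU Ux.
  (* The fold over the first [i.+1] stages ends in [p i], which lies in the filter of the new point
     because I had to play inside [N (p i)]. *)
  apply; first by rewrite mkseqS foldl_rcons.
  by move: UV; rewrite mkseqS map_rcons last_rcons VN; exact.
have [G Gmax pG] := maximal_filter_extension (decreasing_sequence_filter p_dec).
have [x fxG] := f_max G Gmax.
exists x => i _; have [_ [_ _]] := legal i; apply; rewrite VN.
by rewrite /N /UF_nbhd /= fxG; apply: pG; exists i.
Qed.

End PosetFilters.

Theorem theorem5p2 (d : Order.disp_t) (P : porderType d) :
  strong_choquet (MF P) /\ strong_choquet (UF P).
Proof.
split.
- apply: (@strong_choquet_initial _ P (MF P) set_val).
  + exact: initial_continuous.
  + by move=> U [O oO <-]; exists O.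
  + move=> F Fmax; pose x := MkUF (maximal_filter_unbounded Fmax).
    have xM : x \in MF P by rewrite inE.
    by exists (exist _ x xM).
- apply: (@strong_choquet_initial _ P (UF P) id).
  + by move=> x.
  + by move=> U oU; exists U.
  + by move=> F Fmax; exists (MkUF (maximal_filter_unbounded Fmax)).
Qed.
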